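(* Let $F$ be a free non-abelian group and let $w$ be a proper word. Then the set $w[F]$ is not rational in $F$.
   Context: A word is an element $w=w(x_1,\dots,x_n)$ of the free group $F(X)$ with basis $X=\{x_1,x_2,\dots\}$. For a group $G$, $w[G]=\{w(g_1,\dots,g_n) : g_1,\dots,g_n\in G\}$ is the set of all values of $w$ in $G$. The word $w$ is proper if there exist groups $G$ and $H$ such that $w[G]\neq \{1\}$ and $w[H]\neq H$. For a monoid $M$, the family $\mathrm{Rat}(M)$ of rational subsets of $M$ is the smallest family of subsets of $M$ that contains all finite subsets and is closed under union $(L_1,L_2)\mapsto L_1\cup L_2$, product $(L_1,L_2)\mapsto L_1L_2=\{ab : a\in L_1, b\in L_2\}$, and submonoid generation $L\mapsto L^{\ast}$, where $L^{\ast}$ is the submonoid of $M$ generated by $L$. A subset of a group $G$ is rational in $G$ if it belongs to $\mathrm{Rat}(G)$. *)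

(* Defs.v *)
From HB Require Import structures.
From mathcomp Require Import all_boot all_classical.

Set Implicit Arguments.
Unset Strict Implicit.
Unset Printing Implicit Defensive.

Local Open Scope classical_set_scope.
Local Open Scope group_scope.

(* The free group on X, realised by reduced words. The letter (x, false)      *)
(* stands for x and (x, true) for its inverse.                                *)
Section FreeGroup.
Variable X : choiceType.
Implicit Types (l : X * bool) (s t : seq (X * bool)).

Definition letter_inv l := (l.1, ~~ l.2).

Definition reduced s := sorted (fun l m => m != letter_inv l) s.

Record freeGroup := FreeGroup {
  freeGroup_word :> seq (X * bool);
  freeGroup_wordP : reduced freeGroup_word }.

HB.instance Definition _ := [isSub for freeGroup_word].
HB.instance Definition _ := [Choice of freeGroup by <:].

(* Left multiplication of a reduced word by a letter. *)
Definition push l s :=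
  if s is m :: s' then if m == letter_inv l then s' else l :: s else [:: l].

Lemma letter_invK : involutive letter_inv.
Proof. by case=> x b; rewrite /letter_inv /= negbK. Qed.

Lemma reduced_behead l s : reduced (l :: s) -> reduced s.
Proof. exact: path_sorted. Qed.

Lemma reduced_push l s : reduced s -> reduced (push l s).
Proof.
case: s => [//|m s] /= rs; case: ifP => [_|ml]; first exact: reduced_behead rs.
by rewrite /reduced /= ml.
Qed.

Lemma reduced_foldr_push s t : reduced t -> reduced (foldr push t s).
Proof. by move=> rt; elim: s => //= l s; apply: reduced_push. Qed.

Lemma pushVK l s : reduced s -> push l (push (letter_inv l) s) = s.
Proof.
case: s => [|m s] /= rs; first by rewrite eqxx.
rewrite letter_invK; case: eqVneq => [eml|_] /=; last by rewrite eqxx.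
case: s rs => [|k s] /=; first by rewrite eml.
by rewrite /reduced /= eml => /andP[/negbTE-> _].
Qed.

Lemma foldr_push_push l s t :
  reduced t -> foldr push t (push l s) = push l (foldr push t s).
Proof.
case: s => [//|m s] rt /=; case: eqVneq => [->|//].
by rewrite pushVK //; apply: reduced_foldr_push.
Qed.

Lemma foldr_push_id s : reduced s -> foldr push [::] s = s.
Proof.
elim: s => //= l s IHs rls; rewrite IHs; last exact: reduced_behead rls.
by case: s rls {IHs} => //= m s /andP[/negbTE-> _].
Qed.

Lemma foldr_pushV s : foldr push s (rev (map letter_inv s)) = [::].
Proof.
elim: s => //= l s IHs; rewrite rev_cons foldr_rcons /= letter_invK eqxx.
exact: IHs.
Qed.

Definition freeGroup_one := @FreeGroup [::] isT.

Definition freeGroup_mul (u v : freeGroup) :=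
  FreeGroup (reduced_foldr_push u (freeGroup_wordP v)).

Definition freeGroup_inv (u : freeGroup) :=
  FreeGroup (reduced_foldr_push (rev (map letter_inv u)) (isT : reduced [::])).

Lemma freeGroup_mulA : associative freeGroup_mul.
Proof.
move=> u v w; apply: val_inj => /=.
elim: (freeGroup_word u) => //= l s ->.
by rewrite foldr_push_push //; apply: freeGroup_wordP.
Qed.

Lemma freeGroup_mul1 : left_id freeGroup_one freeGroup_mul.
Proof. by move=> u; apply: val_inj. Qed.

Lemma freeGroup_mulr1 : right_id freeGroup_one freeGroup_mul.
Proof.
by move=> u; apply: val_inj; rewrite /= foldr_push_id //; apply: freeGroup_wordP.
Qed.

Lemma freeGroup_mulV : left_inverse freeGroup_one freeGroup_inv freeGroup_mul.
Proof.
move=> u; apply: val_inj; rewrite /= -[RHS](foldr_pushV u).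
elim: (rev _) => //= l s <-.
by rewrite foldr_push_push //; apply: freeGroup_wordP.
Qed.

Lemma freeGroup_mulrV : right_inverse freeGroup_one freeGroup_inv freeGroup_mul.
Proof.
move=> u; set v := freeGroup_inv u.
rewrite -[LHS]freeGroup_mul1 -{1}(freeGroup_mulV v) -freeGroup_mulA.
by rewrite (freeGroup_mulA v) freeGroup_mulV freeGroup_mul1 freeGroup_mulV.
Qed.

HB.instance Definition _ := isGroup.Build freeGroup
  freeGroup_mulA freeGroup_mul1 freeGroup_mulr1 freeGroup_mulV freeGroup_mulrV.

Definition freeGroup_gen (x : X) : freeGroup := @FreeGroup [:: (x, false)] isT.

End FreeGroup.

Section FreeGroupEval.
Variables (X : choiceType) (G : groupType) (g : X -> G).

Definition letter_eval (l : X * bool) : G := if l.2 then (g l.1)^-1 else g l.1.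

(* The image of w under the homomorphism that sends each generator x to g x. *)
Definition freeGroup_eval (w : freeGroup X) : G := \prod_(l <- w) letter_eval l.

Lemma prod_push l s : \prod_(m <- push l s) letter_eval m =
  letter_eval l * \prod_(m <- s) letter_eval m.
Proof.
case: s => [|m s] /=; first by rewrite big_seq1 big_nil mulg1.
case: eqVneq => [->|_]; rewrite !big_cons // /letter_eval /=.
by case: l.2; rewrite /= ?mulKg ?mulVKg.
Qed.

Lemma freeGroup_evalM : {morph freeGroup_eval : u v / u * v}.
Proof.
move=> u v; rewrite /freeGroup_eval /=.
elim: (freeGroup_word u) => [|l s IHs] /=; first by rewrite big_nil mul1g.
by rewrite prod_push IHs big_cons mulgA.
Qed.

Lemma freeGroup_eval_gen x : freeGroup_eval (freeGroup_gen x) = g x.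
Proof. by rewrite /freeGroup_eval big_seq1. Qed.

End FreeGroupEval.

Definition free_basis (F : groupType) (X : Type) (b : X -> F) : Prop :=
  forall (H : groupType) (f : X -> H),
    exists! phi : F -> H,
      {morph phi : u v / u * v} /\ forall x, phi (b x) = f x.

Definition free_group (F : groupType) : Prop :=
  exists (X : Type) (b : X -> F), free_basis b.

Lemma freeGroup_basis (X : choiceType) : free_basis (@freeGroup_gen X).
Proof.
move=> H f; exists (freeGroup_eval f); split=> [|phi [phiM phix]].
  by split; [exact: freeGroup_evalM | exact: freeGroup_eval_gen].
have phi1 : phi 1 = 1 by apply: (mulgI (phi 1)); rewrite -phiM !mulg1.
have phiV u : phi u^-1 = (phi u)^-1.
  by apply: (mulgI (phi u)); rewrite -phiM !mulgV phi1.
apply/funext => -[s rs]; elim: s rs => [|[x e] s IHs] rs.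
  by rewrite /freeGroup_eval big_nil -phi1; congr phi; apply: val_inj.
pose u := FreeGroup (reduced_behead rs).
pose a := @FreeGroup X [:: (x, e)] isT.
have -> : FreeGroup rs = a * u.
  by apply: val_inj; rewrite /= -[LHS]foldr_push_id //= foldr_push_id // (reduced_behead rs).
rewrite freeGroup_evalM phiM IHs; congr (_ * _).
have -> : a = if e then (freeGroup_gen x)^-1 else freeGroup_gen x.
  by apply: val_inj; rewrite /a; case: (e).
by case: (e); rewrite /freeGroup_eval big_seq1 /letter_eval /= ?phiV phix.
Qed.

(* X_0, X_1, X_2, ... are the letters; a word involves finitely many of them. *)
Definition word := freeGroup nat.

(* A tuple of arguments is a sequence nat -> G, of which w reads only the     *)
(* entries at the letters that occur in it.                                   *)
Definition word_values (w : word) (G : groupType) : set G :=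
  [set freeGroup_eval g w | g in [set: nat -> G]].
Arguments word_values w G : clear implicits.

Definition proper_word (w : word) : Prop :=
  (exists G : groupType, word_values w G <> [set 1]) /\
  (exists H : groupType, word_values w H <> [set: H]).

Section Rational.
Variable M : monoidType.
Implicit Types A B : set M.

Definition submonoid A : Prop := A 1 /\ forall a b, A a -> A b -> A (a * b).

Definition generated_submonoid A : set M := smallest submonoid A.

Inductive rational : set M -> Prop :=
| rational_finite A : finite_set A -> rational A
| rational_union A B : rational A -> rational B -> rational (A `|` B)
| rational_product A B :
    rational A -> rational B -> rational [set a * b | a in A & b in B]
| rational_star A : rational A -> rational (generated_submonoid A).

End Rational.

(* Main.v *)
Require Import Defs.
From mathcomp Require Import all_boot all_classical.
From mathcomp Require Import ssralg ssrnum ssrint intdiv zify.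

(** Why a proper word w has a non-rational set R of values in a free group.

A non-abelian free group maps onto the free group G on two letters, and both
rationality and the formation of word values pass to the image, so it is
enough to treat G.

A rational set can be cut along geodesics in finitely many ways
([rational_splittable]): there are finitely many pairs (L_i, M_i) with
L_i M_i inside R such that, whenever p is a prefix of the reduced word of some
x in R, some pair has p in L_i and p^-1 x in M_i. The set R is closed under
conjugation and contains some g != 1, because a non-trivial word is not a law
of G ([freeGroup_no_law]). Cut the conjugates h_k^-1 g h_k, reduced as written,
just after h_k^-1. By the pigeonhole principle the same pair serves two indices
j < k; recombining its two halves gives g h_k h_j^-1 in R ([rational_pump]).

It remains to choose the h_k so that no g h_k h_j^-1 is a value of w. Fix two
letters l and m on different generators, and let gaps_i(x) be the number of
occurrences of l m^i l in the reduced word of x minus the number of its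
occurrences in that of x^-1. Concatenation and cancellation of reduced words
create or destroy occurrences at the junctions only, for at most 6 indices i
altogether; so gaps_i(x y) = gaps_i(x) + gaps_i(y) for all but 6 of the i
([gapsM]). Consequently gaps_i(w(g_1, ..., g_n)) is, for all but 6|w| indices,
the value of w in Z at the integers gaps_i(g_1), ..., gaps_i(g_n)
([gaps_eval]). The values of w in Z form a subgroup, which misses 1 since
otherwise w would take every value in every group; so some d > 1 divides them
all. Hence on R the integer gaps_i is divisible by d except for a bounded
number of i. If h_k is the word l m^a l m^b l ... with a, b, ... running over a
long block of integers, the blocks being disjoint for different k, then
gaps_i(g h_k h_j^-1) is congruent to gaps_i(g) + 1 for nearly all i in the k-th
block, while d divides gaps_i(g) for nearly all i. Once the blocks are longer
than the sum of the bounds this is a contradiction. *)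

Set Implicit Arguments.
Unset Strict Implicit.
Unset Printing Implicit Defensive.

Import GRing.Theory Num.Theory.

Local Open Scope classical_set_scope.
Local Open Scope group_scope.

(** * Reduced words, cancellation and prefixes *)

Section Words.
Variable X : choiceType.
Implicit Types (l m : X * bool) (s t u v : seq (X * bool)).
Implicit Types x y g h : freeGroup X.

Definition word_inv s := rev (map (@letter_inv X) s).

Lemma word_invK : involutive word_inv.
Proof.
move=> s; rewrite /word_inv map_rev revK -map_comp map_id_in //= => l _.
exact: letter_invK.
Qed.

Lemma word_inv_cat s t : word_inv (s ++ t) = word_inv t ++ word_inv s.
Proof. by rewrite /word_inv map_cat rev_cat. Qed.

Lemma reduced_word_inv s : reduced s -> reduced (word_inv s).
Proof.
rewrite /reduced rev_sorted sorted_map; apply: sub_sorted => l m /=.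
by rewrite letter_invK eq_sym.
Qed.

Lemma freeGroup_word_inv x : x^-1 = word_inv x :> seq _.
Proof. exact/foldr_push_id/reduced_word_inv/freeGroup_wordP. Qed.

Lemma freeGroup_word_cat x y :
  reduced (x ++ y) -> x * y = x ++ y :> seq _.
Proof.
move=> rxy; rewrite -[RHS]foldr_push_id // foldr_cat.
by rewrite (foldr_push_id (freeGroup_wordP y)).
Qed.

Lemma foldr_push_word_inv s t :
  reduced t -> foldr (@push X) (foldr (@push X) t (word_inv s)) s = t.
Proof.
rewrite /word_inv; elim: s t => //= l s IHs t rt.
by rewrite rev_cons foldr_rcons IHs ?reduced_push // pushVK.
Qed.

(** In a product of reduced words a suffix c of the left one cancels against
the prefix c^-1 of the right one, and the remaining parts are juxtaposed. *)
Lemma foldr_push_cancel s t : reduced s -> reduced t ->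
  exists a c b, [/\ s = a ++ c, t = word_inv c ++ b
    & foldr (@push X) t s = a ++ b].
Proof.
elim: s => [_ _|l s IHs rls rt] /=; first by exists [::], [::], t.
have [[|k a] [c [b [es et ->]]]] := IHs (reduced_behead rls) rt; last first.
  by exists (l :: k :: a), c, b; move: rls; rewrite es /= => /andP[/negbTE->].
case: b et => [|k b] et /=; first by exists [:: l], c, [::]; rewrite es et.
case: eqVneq et => [->|_] et.
  by exists [::], (l :: c), b; rewrite es et -(cat1s l c) word_inv_cat -catA.
by exists [:: l], c, (k :: b); rewrite es et.
Qed.

(** The Cayley graph is a tree: the geodesic from 1 to x y runs inside the union
of the geodesic from 1 to x and the x-translate of the one from 1 to y. *)
Lemma prefix_mul (p x y : freeGroup X) :
  prefix p (x * y) -> prefix p x \/ prefix (x^-1 * p) y.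
Proof.
have [a [c [b [ex ey exy]]]] :=
  foldr_push_cancel (freeGroup_wordP x) (freeGroup_wordP y).
rewrite [freeGroup_word (x * y)]exy prefixE take_cat; case: ltnP => [_|le_ap] /eqP ep.
  by left; rewrite ex prefix_catl // -ep prefix_take.
(* p reaches into the part b of y that survives, so x^-1 p = c^-1 b1. *)
right; pose b1 := take (size p - size a) b; rewrite -/b1 in ep.
have rt : reduced (word_inv c ++ b1).
  have := freeGroup_wordP y; rewrite ey /reduced -(cat_take_drop (size p - size a) b).
  by rewrite catA => /cat_sorted2[].
have rb : reduced b1 by case/cat_sorted2: rt.
suff -> : p = x * FreeGroup rt.
  by rewrite mulKg /= ey -(cat_take_drop (size p - size a) b) catA prefix_prefix.
apply: val_inj => /=; rewrite ex foldr_cat.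
have -> : foldr (@push X) (word_inv c ++ b1) c = b1.
  by rewrite -(foldr_push_id rt) foldr_cat foldr_push_id // foldr_push_word_inv.
by rewrite -[LHS]foldr_push_id ?freeGroup_wordP // -ep foldr_cat foldr_push_id.
Qed.

Lemma prefix_conj g h :
  reduced (word_inv h ++ g ++ h) -> prefix h^-1 (h^-1 * g * h).
Proof.
move=> r; have rgh : reduced (g ++ h) by case/cat_sorted2: r.
rewrite -mulgA [freeGroup_word (h^-1 * _)]freeGroup_word_cat ?prefix_prefix //.
by rewrite freeGroup_word_inv freeGroup_word_cat.
Qed.

(** Conjugating by a reduced word that starts with l causes no cancellation as
soon as l differs from the first letter of k :: s and from the inverse of its
last letter; in rank 2 such an l exists for any reduced word. *)
Lemma reduced_conj l k s t :
  l != k -> l != letter_inv (last k s) ->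
  reduced (k :: s) -> reduced (l :: t) ->
  reduced (word_inv (l :: t) ++ (k :: s) ++ l :: t).
Proof.
move=> lk ls rs rt; rewrite /reduced cat_cons sorted_cat_cons.
rewrite -rev_cons cat_path /= ls; move: (rs) (rt) => /= -> ->; rewrite !andbT.
rewrite rev_sorted /= letter_invK eq_sym lk /=.
have := reduced_word_inv rt.
by rewrite /reduced rev_sorted.
Qed.

End Words.

Lemma exists_letter (k m : bool * bool) :
  exists l, l != k /\ l != m.
Proof.
move: k m => [[] []] [[] []]; first [by exists (true, true)
 | by exists (true, false) | by exists (false, true)| by exists (false, false)].
Qed.

(** * Cutting rational sets along geodesics *)

Section Splitting.
Variable X : choiceType.
Implicit Types (x y p : freeGroup X) (A B R : set (freeGroup X)).

(** This is the trace that a finite automaton for R leaves on reduced words: a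
run on a word representing x visits every vertex p of the geodesic from 1 to x,
and L_i, M_i collect what is read before and after the i-th state. The pairs are
built here along the rational operations, without an automaton. *)
Definition splittable R := exists (I : finType) (L M : I -> set (freeGroup X)),
  (forall i a b, L i a -> M i b -> R (a * b)) /\
  (forall x p, R x -> prefix p x -> exists i, L i p /\ M i (p^-1 * x)).

Lemma splittable_set1 x : splittable [set x].
Proof.
(* A prefix of x is determined by its length, which serves as index. *)
exists 'I_(size x).+1.
exists (fun i : 'I_(size x).+1 => [set p : freeGroup X |
  prefix p x /\ size p = i]).
exists (fun i : 'I_(size x).+1 => [set q | exists p : freeGroup X,
  [/\ prefix p x, size p = i & q = p^-1 * x]]).
split=> [i a _ [ax sa] [p [px sp ->]]|_ p -> px].
  suff -> : a = p by rewrite mulVKg.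
  move: ax px; rewrite !prefixE sa sp => /eqP ea /eqP ep.
  by apply: val_inj; rewrite /= -ea -ep.
have sp : size p < (size x).+1 by rewrite ltnS size_prefix.
by exists (Ordinal sp); split; [|exists p].
Qed.

Lemma splittableU A B : splittable A -> splittable B -> splittable (A `|` B).
Proof.
move=> [I [L [M [AI IA]]]] [J [L' [M' [BJ JB]]]].
exists (I + J)%type, (fun k => match k with inl i => L i | inr j => L' j end).
exists (fun k => match k with inl i => M i | inr j => M' j end).
split=> [[i|j] a b|x p [Ax|Bx] px].
- by move=> La Mb; left; apply: AI La Mb.
- by move=> La Mb; right; apply: BJ La Mb.
- by have [i] := IA _ _ Ax px; exists (inl i).
- by have [j] := JB _ _ Bx px; exists (inr j).
Qed.

Lemma splittable_finite A : finite_set A -> splittable A.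
Proof.
move=> /finite_seqP[s ->]; elim: s => [|x s IHs].
  by exists void, (fun=> set0), (fun=> set0); split=> [[]|x p].
suff -> : [set` x :: s] = [set x] `|` [set` s].
  exact/splittableU/IHs/splittable_set1.
apply/seteqP; split=> y /=; rewrite inE.
  by move=> /predU1P[->|]; [left|right].
by move=> [->|ys]; rewrite ?eqxx ?ys ?orbT.
Qed.

Lemma splittableM A B : splittable A -> splittable B ->
  splittable [set a * b | a in A & b in B].
Proof.
move=> [I [L [M [AI IA]]]] [J [L' [M' [BJ JB]]]].
exists (I + J)%type, (fun k => match k with
  | inl i => L i | inr j => [set a * p | a in A & p in L' j] end).
exists (fun k => match k with
  | inl i => [set q * b | q in M i & b in B] | inr j => M' j end).
split=> [[i|j] p q|_ p [a Aa [b Bb <-]]].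
- move=> Lp [q' Mq [b Bb <-]]; exists (p * q'); first exact: AI Lp Mq.
  by exists b; rewrite ?mulgA.
- move=> [a Aa [p' Lp <-]] Mq; exists a => //.
  by exists (p' * q); rewrite ?mulgA //; apply: BJ Lp Mq.
move=> /prefix_mul[pa|pb].
  have [i [Lp Mp]] := IA _ _ Aa pa; exists (inl i); split=> //.
  by exists (p^-1 * a) => //; exists b; rewrite ?mulgA.
have [j [Lp Mp]] := JB _ _ Bb pb; exists (inr j); split.
  by exists a => //; exists (a^-1 * p); rewrite ?mulVKg.
by move: Mp; rewrite invgM invgK mulgA.
Qed.

Lemma submonoid_generated (M : monoidType) (A : set M) :
  submonoid (generated_submonoid A).
Proof.
split=> [B [[B1 _] _] //|a b Aa Ab B sB].
by case: (sB) => -[_ BM] _; apply: BM; [apply: Aa|apply: Ab].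
Qed.

(** With S the submonoid generated by A, a cut of a product a_1 ... a_n of
elements of A falls inside one factor, so its left part is in S L_i and its
right part in M_i S; the additional index None, with the pair (S, S), serves the
empty product. *)
Lemma splittable_star A : splittable A -> splittable (generated_submonoid A).
Proof.
move=> [I [L [M [AI IA]]]]; set S := generated_submonoid A.
have [S1 SM] : submonoid S by apply: submonoid_generated.
have AS : A `<=` S by apply: sub_gen_smallest.
pose L' i := if i is Some i then [set a * p | a in S & p in L i] else S.
pose M' i := if i is Some i then [set q * a | q in M i & a in S] else S.
have SL i a p : S a -> L' i p -> L' i (a * p).
  case: i => [i|] /= Sa; last exact: SM.
  by move=> [b Sb [q Lq <-]]; exists (a * b); [apply: SM|exists q; rewrite ?mulgA].
have MS i a q : S a -> M' i q -> M' i (q * a).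
  case: i => [i|] /= Sa; last by move=> Sq; apply: SM.
  by move=> [p Mp [b Sb <-]]; exists p => //; exists (b * a); [apply: SM|rewrite mulgA].
exists (option I), L', M'; split=> [[i|] p q|].
- move=> [a Sa [p' Lp <-]] [q' Mq [b Sb <-]].
  rewrite -mulgA [p' * _]mulgA; apply: (SM) => //; apply: SM => //.
  by apply: AS; apply: AI Lp Mq.
- exact: SM.
(* Induction on generated elements needs closure of Q under products only. *)
pose Q := [set x | S x /\
  forall p, prefix p x -> exists i, L' i p /\ M' i (p^-1 * x)].
suff SQ : S `<=` Q by move=> x p /SQ[_]; apply.
apply: smallest_sub => [|x Ax]; last first.
  split=> [|p px]; first exact: AS.
  have [i [Lp Mp]] := IA _ _ Ax px; exists (Some i); split.
    by exists 1 => //; exists p; rewrite ?mul1g.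
  by exists (p^-1 * x) => //; exists 1; rewrite ?mulg1.
split=> [|x y [Sx Qx] [Sy Qy]].
  split=> // p; rewrite prefixs0 => /eqP p1.
  have -> : p = 1 by apply: val_inj.
  by exists None; rewrite mulg1 invg1.
split=> [|p /prefix_mul[/Qx|/Qy] [i [Lp Mp]]]; first exact: SM.
  by exists i; rewrite mulgA; split=> //; apply: MS.
exists i; split; first by rewrite -[p](mulVKg x); apply: SL.
by move: Mp; rewrite invgM invgK mulgA.
Qed.

Lemma rational_splittable R : rational R -> splittable R.
Proof.
elim=> [A|A B _ sA _|A B _ sA _|A _].
- exact: splittable_finite.
- exact: splittableU.
- exact: splittableM.
- exact: splittable_star.
Qed.

(** Only finitely many pairs are available to cut h_k^-1 g h_k after h_k^-1, so
two indices j < k share one, and h_j^-1 g h_k lies in R as well. *)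
Lemma rational_pump R (g : freeGroup X) (h : nat -> freeGroup X) :
  rational R -> (forall x y, R x -> R (y^-1 * x * y)) -> R g ->
  (forall k, prefix (h k)^-1 ((h k)^-1 * g * h k)) ->
  exists j k, j < k /\ R (g * (h k * (h j)^-1)).
Proof.
move=> /rational_splittable[I [L [M [RI IR]]]] RJ Rg hP.
have /choice[f fP] : forall k, exists i, L i (h k)^-1 /\ M i (g * h k).
  move=> k; have [i [Li]] := IR _ _ (RJ _ (h k) Rg) (hP k).
  by rewrite -mulgA mulKg; exists i.
have /injectivePn[a [b ab fab]] : ~~ injectiveb (fun k : 'I_#|I|.+1 => f k).
  by apply/negP => /injectiveP/leq_card; rewrite card_ord ltnn.
wlog lt_ab : a b ab fab / a < b.
  move=> wl; have := ab; rewrite -val_eqE neq_ltn => /orP[|] lt; first exact: wl lt.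
  by apply: wl lt; rewrite // eq_sym.
exists a, b; split=> //.
have := RI _ _ _ (fP a).1; rewrite fab => /(_ _ (fP b).2) /(RJ _ (h a)^-1).
by rewrite invgK mulVKg mulgA.
Qed.

End Splitting.

(** * Properties of all but boundedly many indices *)

Definition almost (C : nat) (P : nat -> Prop) :=
  exists2 s : seq nat, size s <= C & forall i, i \notin s -> P i.

Lemma almost_forall C (P : nat -> Prop) : (forall i, P i) -> almost C P.
Proof. by move=> HP; exists [::]. Qed.

Lemma almost_and C D (P Q : nat -> Prop) :
  almost C P -> almost D Q -> almost (C + D) (fun i => P i /\ Q i).
Proof.
move=> [s sC sP] [t tD tQ]; exists (s ++ t); first by rewrite size_cat leq_add.
by move=> i; rewrite mem_cat => /norP[/sP ? /tQ].
Qed.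

Lemma almost_imp C D (P Q : nat -> Prop) : C <= D ->
  (forall i, P i -> Q i) -> almost C P -> almost D Q.
Proof.
by move=> CD PQ [s sC sP]; exists s => [|i /sP/PQ //]; apply: leq_trans CD.
Qed.

Lemma almost_ex C (P : nat -> Prop) (s : seq nat) :
  almost C P -> uniq s -> C < size s -> exists2 i, i \in s & P i.
Proof.
move=> [t tC tP] us ltCs; case: (boolP (all [in t] s)) => [/allP st|].
  by have := leq_trans ltCs (leq_trans (uniq_leq_size us st) tC); rewrite ltnn.
by case/allPn => i si it; exists i => //; apply: tP.
Qed.

(** * Occurrences of l m^i l in a sequence *)

Section Count.
Variable T : eqType.
Implicit Types (p s t : seq T).

Fixpoint occ p s : nat :=
  if s is _ :: s' then prefix p s + occ p s' else 0.

Lemma occ_notin l p s : l \notin s -> occ (l :: p) s = 0.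
Proof.
elim: s => //= k s IHs; rewrite inE negb_or => /andP[/negbTE-> /IHs->].
by [].
Qed.

Variables l m : T.
Hypothesis lm : l != m.

Definition gap i := l :: rcons (nseq i m) l.

Lemma prefix_gap_tail i j s :
  prefix (rcons (nseq i m) l) (nseq j m ++ l :: s) = (i == j).
Proof.
elim: i j => [|i IHi] [|j] //=; rewrite ?eqxx ?prefix0s ?(negbTE lm) //.
  by rewrite eq_sym (negbTE lm).
exact: IHi.
Qed.

Lemma occ_gap_nseq i j s : occ (gap i) (nseq j m ++ s) = occ (gap i) s.
Proof. by elim: j => //= j ->; rewrite (negbTE lm). Qed.

Lemma occ_gap_run i j s :
  occ (gap i) (l :: nseq j m ++ l :: s) = (i == j) + occ (gap i) (l :: s).
Proof. by rewrite [LHS]/= eqxx prefix_gap_tail occ_gap_nseq. Qed.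

Lemma prefix_gap_cat i s t : has (predC1 m) s ->
  prefix (rcons (nseq i m) l) (s ++ t) = prefix (rcons (nseq i m) l) s.
Proof.
elim: i s => [|i IHi] [|k s] //=; rewrite ?prefix0s // eq_sym.
by case: eqVneq => //= _; apply: IHi.
Qed.

Lemma prefix_gap_nseq i j t :
  prefix (rcons (nseq i m) l) (nseq j m ++ t) -> i = j + find (predC1 m) t.
Proof.
elim: i j t => [|i IHi] [|j] t //=.
- by case: t => //= k t /andP[/eqP<- _]; rewrite lm.
- by rewrite (negbTE lm).
- case: t => //= k t /andP[/eqP<-]; rewrite eqxx /= => h.
  by rewrite (IHi 0 _ h).
- by rewrite eqxx /= => /IHi->.
Qed.

(** An occurrence of l m^i l that straddles the junction starts at the last l of
s, followed in s by a run of m only; then i is the length of that run plus the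
length of the initial run of m in t, hence is determined by s and t. *)
Lemma occ_gap_cat s t :
  almost 1 (fun i => occ (gap i) (s ++ t) = occ (gap i) s + occ (gap i) t).
Proof.
elim: s => [|k s IHs]; first exact: almost_forall.
have [hs|hs] := boolP (has (predC1 m) s).
  by apply: almost_imp IHs => // i /= ->; rewrite prefix_gap_cat // addnA.
have es : s = nseq (size s) m.
  by apply/all_pred1P/allP => k' ks; apply: contraR hs => km; apply/hasP; exists k'.
rewrite {}es; move: (size s) => j {s IHs hs}.
exists [:: j + find (predC1 m) t] => // i; rewrite inE => ni.
have e0 : occ (gap i) (nseq j m) = 0 by rewrite -[nseq j m]cats0 occ_gap_nseq.
rewrite /= occ_gap_nseq e0 addn0; congr (_ + _).
have /negbTE-> : ~~ prefix (rcons (nseq i m) l) (nseq j m ++ t).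
  by apply: contra ni => /prefix_gap_nseq->.
have /negbTE-> : ~~ prefix (rcons (nseq i m) l) (nseq j m).
  apply/negP => /prefixP[s' /(congr1 (mem^~ l))]; rewrite /= mem_cat mem_rcons inE eqxx.
  by rewrite mem_nseq (negbTE lm) andbF.
by [].
Qed.

(** The sequence l m^j1 l m^j2 l ... m^jr l, with prescribed gaps between
consecutive occurrences of l. *)
Definition train (js : seq nat) := foldr (fun j s => l :: nseq j m ++ s) [:: l] js.

Lemma occ_gap_train i js : occ (gap i) (train js) = count_mem i js.
Proof.
elim: js => [|j js IHjs] /=.
  by rewrite eqxx; case: i.
rewrite -IHjs [in LHS](_ : train js = l :: behead (train js)); last by case: (js).
have := occ_gap_run i j (behead (train js)); rewrite /= => ->.
by rewrite eq_sym; case: (js).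
Qed.

Lemma train_subset js : {subset train js <= [:: l; m]}.
Proof.
elim: js => [|j js IHjs] k /=; first by rewrite !inE => /eqP->; rewrite eqxx.
by rewrite inE mem_cat => /or3P[/eqP->|/nseqP[-> _]|/IHjs //];
  rewrite !inE eqxx ?orbT.
Qed.

End Count.

(** * Signed gap counts on the free group *)

Section Gaps.
Variable X : choiceType.
Variables l m : X * bool.
Hypothesis lm : l.1 != m.1.
Implicit Types (s t : seq (X * bool)) (x y : freeGroup X).
Local Open Scope ring_scope.

(** Subtracting the count for the inverse makes gaps_i odd, so that the two
copies of the part that cancels in a product contribute nothing in total. *)
Definition gaps (i : nat) s : int :=
  (occ (gap l m i) s)%:Z - (occ (gap l m i) (word_inv s))%:Z.

Let lm' : l != m. Proof. by apply: contraNneq lm => ->. Qed.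

Lemma gapsV i s : gaps i (word_inv s) = - gaps i s.
Proof. by rewrite /gaps word_invK opprB. Qed.

Lemma gaps_cat s t :
  almost 2 (fun i => gaps i (s ++ t) = gaps i s + gaps i t).
Proof.
have := almost_and (occ_gap_cat lm' s t) (occ_gap_cat lm' (word_inv t) (word_inv s)).
apply: almost_imp => // i [st ts].
rewrite /gaps word_inv_cat st ts; lia.
Qed.

(** With x = a c, y = c^-1 b and x y = a b reduced, each of the three junctions
spoils additivity for at most 2 indices, and c, c^-1 contribute opposite
values. *)
Lemma gapsM x y :
  almost 6 (fun i => gaps i (x * y)%g = gaps i x + gaps i y).
Proof.
have [a [c [b [ex ey exy]]]] :=
  foldr_push_cancel (freeGroup_wordP x) (freeGroup_wordP y).
have := almost_and (gaps_cat a b)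
  (almost_and (gaps_cat a c) (gaps_cat (word_inv c) b)).
apply: almost_imp => // i [ab [ac cb]].
rewrite [freeGroup_word (x * y)%g]exy ex ey ab ac cb gapsV; lia.
Qed.

Lemma gaps_inv i x : gaps i x^-1%g = - gaps i x.
Proof. by rewrite freeGroup_word_inv gapsV. Qed.

Lemma reduced_train js : reduced (train l m js).
Proof.
have kP k : k \in [:: l; m] -> (k == l) || (k == m) by rewrite !inE.
have h : all [in [:: l; m]] (train l m js) by apply/allP/train_subset.
rewrite /reduced; set s := train l m js in h *.
have : sorted (fun _ _ => true) s by case: (s) => //= k s0; elim: s0 k => //=.
apply: sub_in_sorted h => k k' /kP/orP[] /eqP-> /kP/orP[] /eqP-> _.
all: apply/eqP => e; have e1 := congr1 fst e; have := congr1 snd e.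
all: move: lm; rewrite ?e1 /= ?eqxx //.
- by case: l.2.
- by move=> _; case: m.2.
Qed.

Lemma gaps_train js i : gaps i (train l m js) = (count_mem i js)%:Z.
Proof.
rewrite /gaps occ_gap_train // occ_notin ?subr0 //.
rewrite /word_inv mem_rev; apply/mapP => -[k /train_subset].
rewrite !inE => /orP[] /eqP-> e; have := congr1 snd e; have := congr1 fst e.
  by move=> _ /=; case: l.2.
by move=> /= e1; move: lm; rewrite e1 eqxx.
Qed.

End Gaps.

(** * Values of a word in the integers *)

Section ExponentSum.
Variable w : word.
Local Open Scope ring_scope.

(** The value of w in the additive group of integers; only the exponent sums of
the letters of w matter for it. *)
Definition exponent_value (f : nat -> int) : int :=
  \sum_(l <- freeGroup_word w) (if l.2 then - f l.1 else f l.1).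

Lemma exponent_valueB f0 f c :
  exponent_value (fun n => f n - c * f0 n) =
  exponent_value f - c * exponent_value f0.
Proof.
rewrite /exponent_value mulr_sumr -sumrB; apply: eq_bigr => l _.
by case: l.2; lia.
Qed.

Definition expgz (H : groupType) (h : H) (z : int) : H :=
  match z with Posz n => h ^+ n | Negz n => h ^- n.+1 end%g.

Lemma expgzS (H : groupType) (h : H) z : expgz h (1 + z) = (h * expgz h z)%g.
Proof.
case: z => [n|[|n]]; first by rewrite -[1 + _]/(Posz n.+1) /= expgS.
  by rewrite /= expg1 mulgV.
have -> : 1 + Negz n.+1 = Negz n by lia.
by rewrite /= (expgSr _ n.+1) invgM mulVKg.
Qed.

Lemma expgzD (H : groupType) (h : H) a b :
  expgz h (a + b) = (expgz h a * expgz h b)%g.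
Proof.
elim/int_ind: a => [|n IHn|n IHn]; first by rewrite add0r /= mul1g.
  by rewrite -addn1 PoszD [_ + 1]addrC -addrA !expgzS IHn mulgA.
apply: (mulgI h); rewrite mulgA -!expgzS addrA.
by have -> : 1 + - n.+1%:Z = - n%:Z by lia.
Qed.

Lemma expgzN (H : groupType) (h : H) a : expgz h (- a) = (expgz h a)^-1%g.
Proof. by apply: (mulgI (expgz h a)); rewrite -expgzD subrr mulgV. Qed.

Lemma freeGroup_eval_expgz (H : groupType) (h : H) f :
  freeGroup_eval (fun n => expgz h (f n)) w = expgz h (exponent_value f).
Proof.
rewrite /freeGroup_eval /exponent_value.
elim: (freeGroup_word w) => [|l s IHs]; first by rewrite !big_nil.
rewrite !big_cons expgzD IHs /letter_eval; congr (_ * _)%g.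
by case: l.2; rewrite ?expgzN.
Qed.

(** If w takes the value 1 in the integers at f, then it takes the value h in any
group at the powers h ^ f n. *)
Lemma exponent_value_neq1 (H : groupType) :
  word_values w H <> [set: H] -> forall f, exponent_value f <> 1.
Proof.
move=> nH f f1; apply: nH; apply/seteqP; split=> h // _.
by exists (fun n => expgz h (f n)) => //; rewrite freeGroup_eval_expgz f1.
Qed.

(** The integers taken by w form a subgroup; it is generated by its least
positive element, which is not 1, or it is zero, and then any d works. *)
Lemma exponent_value_dvd : (forall f, exponent_value f <> 1) ->
  exists2 d : nat, (1 < d)%N & forall f, (d %| exponent_value f)%Z.
Proof.
move=> w1; have [[f f0]|w0] := pselect (exists f, exponent_value f != 0); last first.
  exists 2%N => // f; apply: contrapT => fd; apply: w0; exists f.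
  by apply: contra_notN fd => /eqP->; rewrite dvdz0.
pose P n := `[< exists f, exponent_value f = n.+1%:Z >].
have Pn : exists n, P n.
  wlog f_gt0 : f f0 / 0 < exponent_value f.
    move=> wl; have [|f_le0] := boolP (0 < exponent_value f); first exact: wl.
    have e : exponent_value (fun n => 0 - 1 * f n) = - exponent_value f.
      rewrite (exponent_valueB f (fun=> 0) 1) mul1r [X in X - _]big1 ?sub0r //.
      by move=> l _; case: l.2; rewrite ?oppr0.
    by apply: (wl (fun n => 0 - 1 * f n)); rewrite e; lia.
  exists `|exponent_value f|.-1%N; apply/asboolP; exists f; lia.
case: (ex_minnP Pn) => n /asboolP[f0' f0n] nmin.
exists n.+1 => [|f1].
  by case: n f0n {nmin} => // /w1.
apply/dvdz_mod0P.
have e := exponent_valueB f0' f1 (exponent_value f1 %/ n.+1)%Z.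
have lt := @ltz_pmod (exponent_value f1) n.+1 isT.
have ge := @modz_ge0 (exponent_value f1) n.+1 isT.
have dv := divz_eq (exponent_value f1) n.+1.
(* A nonzero remainder would be a smaller positive value of w. *)
case: (eqVneq (exponent_value f1 %% n.+1)%Z 0) => // ne.
have := nmin `|(exponent_value f1 %% n.+1)%Z|.-1%N; rewrite leqNgt.
have -> : P `|(exponent_value f1 %% n.+1)%Z|.-1%N.
  apply/asboolP; exists (fun k => f1 k - (exponent_value f1 %/ n.+1)%Z * f0' k).
  rewrite e f0n; lia.
move=> /(_ isT)/negP[]; lia.
Qed.

Variables (X : choiceType) (l m : X * bool).
Hypothesis lm : l.1 != m.1.

(** Each letter of w costs one multiplication, hence at most 6 exceptional
indices. *)
Lemma gaps_eval (g : nat -> freeGroup X) :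
  almost (6 * size w)
    (fun i => gaps l m i (freeGroup_eval g w) =
              exponent_value (fun n => gaps l m i (g n))).
Proof.
rewrite /freeGroup_eval /exponent_value.
elim: (freeGroup_word w) => [|k s IHs].
  by apply: almost_forall => i; rewrite !big_nil.
rewrite big_cons; set y := bigop _ _ _ in IHs *.
apply: almost_imp (almost_and (gapsM lm (letter_eval g k) y) IHs) => [|i [-> ->]].
  by rewrite /= mulnS.
rewrite big_cons /letter_eval; congr (_ + _).
by case: k.2; rewrite ?gaps_inv.
Qed.

End ExponentSum.

(** * Non-trivial words are not laws of the free group of rank 2 *)

Section Push.
Variable X : choiceType.
Implicit Types (l : X * bool) (s : seq (X * bool)) (x : freeGroup X).

Lemma push_cons l s : head l s != letter_inv l -> push l s = l :: s.
Proof. by case: s => //= k s /negbTE->. Qed.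

Lemma iter_push_cat k l s :
  head l s != letter_inv l -> iter k (push l) s = nseq k l ++ s.
Proof.
move=> ls; elim: k => //= k ->; rewrite push_cons //.
by case: k => //= k; case: l {ls} => c [] /=; apply/eqP => -[].
Qed.

Lemma iter_push_cancel k l j s :
  iter k (push (letter_inv l)) (nseq (k + j) l ++ s) = nseq j l ++ s.
Proof.
by elim: k => // k IHk; rewrite iterSr /= letter_invK eqxx.
Qed.

Definition letter l : freeGroup X := @FreeGroup X [:: l] isT.

Lemma letterV l : (letter l)^-1 = letter (letter_inv l).
Proof. exact: val_inj. Qed.

Lemma letterX_mul k l x : letter l ^+ k * x = iter k (push l) x :> seq _.
Proof. by rewrite -iter_mulg; elim: k => //= k ->. Qed.

End Push.

(** The conjugates a^(n+1) b a^-(n+1) generate a free group of infinite rank. *)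
Definition conj_gen (n : nat) : freeGroup bool :=
  letter (false, false) ^+ n.+1 * letter (true, false)
    * letter (false, false) ^- n.+1.

Lemma letter_eval_conj_gen k : letter_eval conj_gen k =
  letter (false, false) ^+ k.1.+1 * letter (true, k.2)
    * letter (false, false) ^- k.1.+1.
Proof.
case: k => n [] //; rewrite /letter_eval /conj_gen /= !invgM invgK mulgA.
by rewrite letterV.
Qed.

(** The prefix a^(n+1) b^(+-1) contributed by the first letter survives: the next
factor either has another power of a in front, which leaves a nonzero power of a
after b^(+-1), or the same power, in which case the two powers of b have the
same sign because s is reduced. *)
Lemma prod_conj_gen (s : seq (nat * bool)) : reduced s ->
  if s is k :: _ then exists t, \prod_(i <- s) letter_eval conj_gen i =
    nseq k.1.+1 (false, false) ++ (true, k.2) :: t :> seq _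
  else True.
Proof.
elim: s => // k s IHs rks; have := IHs (reduced_behead rks).
rewrite big_cons letter_eval_conj_gen -expVgn letterV.
set y := bigop _ _ _ => ey.
set z := letter (letter_inv (false, false)) ^+ k.1.+1 * y.
suff hz : head (true, k.2) z != (true, ~~ k.2).
  exists z; rewrite -!mulgA [freeGroup_word _]letterX_mul.
  rewrite -[freeGroup_word (letter (true, k.2) * _)]/(push (true, k.2) z).
  by rewrite push_cons // iter_push_cat.
rewrite /z letterX_mul; case: s rks @y ey {IHs z} => [|k' s] rks y ey.
  by rewrite /y big_nil iter_push_cat.
case: ey => t ->; case: (ltngtP k.1 k'.1) => [lt|gt|e].
- rewrite -(subnKC (leqW lt)) iter_push_cancel.
  have: 0 < k'.1.+1 - k.1.+1 by rewrite subn_gt0.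
  by case: (_ - _)%N.
- rewrite -(subnK (leqW gt)) iterD -[X in nseq X _]addn0 iter_push_cancel.
  have: 0 < k.1.+1 - k'.1.+1 by rewrite subn_gt0.
  by rewrite iter_push_cat //=; case: (_ - _)%N.
- rewrite e -[X in nseq X _]addn0 iter_push_cancel /=.
  move: rks; rewrite /reduced /= => /andP[+ _]; apply: contra => /eqP[e2].
  by rewrite /letter_inv e -e2 -surjective_pairing.
Qed.

Lemma freeGroup_no_law (w : word) : w <> 1 ->
  exists g : nat -> freeGroup bool, freeGroup_eval g w <> 1.
Proof.
move=> w1; exists conj_gen => e.
have := prod_conj_gen (freeGroup_wordP w).
case ew : (freeGroup_word w) => [|k s]; first by move=> _; apply: w1; apply: val_inj.
by rewrite -ew -/(freeGroup_eval conj_gen w) e => -[].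
Qed.

(** * Homomorphic images, and reduction to rank 2 *)

Section Morphisms.
Variables (G H : groupType) (phi : G -> H).
Hypothesis phiM : {morph phi : x y / x * y}.

Lemma group_morph1 : phi 1 = 1.
Proof. by apply: (mulgI (phi 1)); rewrite -phiM !mulg1. Qed.

Lemma group_morphV x : phi x^-1 = (phi x)^-1.
Proof. by apply: (mulgI (phi x)); rewrite -phiM !mulgV group_morph1. Qed.

Lemma freeGroup_eval_morph (X : choiceType) (g : X -> G) u :
  phi (freeGroup_eval g u) = freeGroup_eval (phi \o g) u.
Proof.
rewrite /freeGroup_eval (big_morph phi phiM group_morph1); apply: eq_bigr => l _.
by rewrite /letter_eval; case: l.2; rewrite ?group_morphV.
Qed.

Lemma rational_image A : rational A -> rational (phi @` A).
Proof.
elim=> [B fB|B C _ rB _ rC|B C _ rB _ rC|B _ rB].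
- exact/rational_finite/finite_image.
- by rewrite image_setU; apply: rational_union.
- suff -> : phi @` [set a * b | a in B & b in C] =
            [set a * b | a in phi @` B & b in phi @` C] by apply: rational_product.
  apply/seteqP; split=> y.
    move=> [_ [a Ba [b Cb <-]] <-]; exists (phi a); first by exists a.
    by exists (phi b); [exists b|rewrite phiM].
  move=> [_ [a Ba <-] [_ [b Cb <-] <-]]; exists (a * b) => //.
  by exists a => //; exists b.
suff -> : phi @` generated_submonoid B = generated_submonoid (phi @` B).
  exact: rational_star.
have [S1 SM] := submonoid_generated B.
have [T1 TM] := submonoid_generated (phi @` B).
apply/seteqP; split.
  move=> _ [x Bx <-]; move: x Bx.
  apply: (@smallest_sub _ _ B (phi @^-1` generated_submonoid (phi @` B))).
    by split=> [|a b] /=; rewrite ?group_morph1 ?phiM; [exact: T1|exact: TM].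
  by move=> x Bx /=; apply: sub_gen_smallest; exists x.
apply: smallest_sub; last first.
  by move=> _ [x Bx <-]; exists x => //; apply: sub_gen_smallest.
split=> [|_ _ [a Sa <-] [b Sb <-]]; first by exists 1; rewrite ?group_morph1.
by exists (a * b); [apply: SM|rewrite phiM].
Qed.

Lemma word_values_image w : (forall y, exists x, phi x = y) ->
  phi @` word_values w G = word_values w H.
Proof.
move=> /choice[psi psiK]; apply/seteqP; split=> y.
  by move=> [_ [g _ <-] <-]; exists (phi \o g); rewrite ?freeGroup_eval_morph.
move=> [g _ <-]; exists (freeGroup_eval (psi \o g) w); first by exists (psi \o g).
rewrite freeGroup_eval_morph; congr freeGroup_eval.
by apply/funext => n /=.
Qed.

End Morphisms.

(** By uniqueness of extensions, an endomorphism that fixes the basis is the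
identity. Applied to conjugations, this shows first that the basis elements are
central and then that every element is. *)
Lemma free_basis_commute (F : groupType) (X : Type) (b : X -> F) :
  free_basis b -> (forall x y, commute (b x) (b y)) -> commutative (@mul F).
Proof.
move=> bP bC.
have fixed (psi : F -> F) : {morph psi : u v / u * v} ->
    (forall x, psi (b x) = b x) -> forall u, psi u = u.
  move=> psiM psib u; have [phi [_ phiU]] := bP F b.
  by rewrite -(phiU psi) ?(phiU id).
have central v : (forall x, commute v (b x)) -> forall u, commute v u.
  move=> vb u; rewrite /commute [RHS]conjgC (fixed (conjg^~ v)) // => [x y|x].
    exact: conjMg.
  by rewrite conjgE -vb mulKg.
by move=> u v; apply: (central) => x; apply/commute_sym; apply: central.
Qed.

Lemma freeGroup_eval_id (X : choiceType) (u : freeGroup X) :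
  freeGroup_eval (@freeGroup_gen X) u = u.
Proof.
have [phi [_ phiU]] := freeGroup_basis (@freeGroup_gen X).
rewrite -(phiU (freeGroup_eval (@freeGroup_gen X))) ?(phiU id) //.
by split; [apply: freeGroup_evalM|apply: freeGroup_eval_gen].
Qed.

(** Two basis elements that do not commute are sent to the two generators and
all others to 1. *)
Lemma free_group_onto_rank2 (F : groupType) :
  free_group F -> ~ commutative (@mul F) ->
  exists phi : F -> freeGroup bool,
    {morph phi : x y / x * y} /\ forall y, exists x, phi x = y.
Proof.
move=> [X [b bP]] nC.
have [x [y nxy]] : exists x y, b x * b y <> b y * b x.
  apply: contrapT => nE; apply: nC; apply: (free_basis_commute bP) => x y.
  by apply: contrapT => nxy; apply: nE; exists x, y.
have xy : y <> x by move=> e; apply: nxy; rewrite e.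
have [phi [[phiM phib] _]] := bP _ (fun z =>
  if `[< z = x >] then freeGroup_gen true else
  if `[< z = y >] then freeGroup_gen false else 1).
exists phi; split=> // u.
exists (freeGroup_eval (fun c : bool => if c then b x else b y) u).
rewrite freeGroup_eval_morph // -[RHS]freeGroup_eval_id; congr freeGroup_eval.
by apply/funext => -[]; rewrite /= phib; do ?case: asboolP.
Qed.

Lemma word_values_conj w (G : groupType) (x y : G) :
  word_values w G x -> word_values w G (y^-1 * x * y).
Proof.
move=> [g _ <-]; exists (conjg^~ y \o g) => //.
by rewrite -freeGroup_eval_morph ?conjgE ?mulgA // => u v; rewrite conjMg.
Qed.

(** * Non-rationality *)

(** The blocks have length N, larger than the number of indices spoilt by g and
by g h_k h_j^-1 (C each, as elements of the set of values) and by the two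
multiplications in g h_k h_j^-1 (6 each). An index i of block k outside the
exceptions has gaps_i(g) and gaps_i(g) + 1 - 0 both divisible by d. *)
Lemma word_values_rank2_not_rational (w : word) (d : nat) :
  w <> 1 -> 1 < d -> (forall f, (d %| exponent_value w f)%Z) ->
  ~ rational (word_values w (freeGroup bool)).
Proof.
move=> /freeGroup_no_law[g0 g01] d1 wd ratR.
set R := word_values w (freeGroup bool) in ratR.
pose g := freeGroup_eval g0 w.
have Rg : R g by exists g0.
case eg : (freeGroup_word g) => [|k s]; first by apply: g01; apply: val_inj.
have [l [lk ls]] := exists_letter k (letter_inv (last k s)).
pose m := (~~ l.1, false).
have lm : l.1 != m.1 by rewrite /m /=; case: l.1.
pose C := (6 * size w)%N; pose N := (C + C + 12).+1.
pose h j := FreeGroup (reduced_train lm (iota (j * N)%N N)).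
have hP j : prefix (h j)^-1 ((h j)^-1 * g * h j).
  apply: prefix_conj; rewrite eg [freeGroup_word (h j)]/= /N /=.
  apply: reduced_conj => //; last exact: (freeGroup_wordP (h j)).
  by rewrite -eg; apply: freeGroup_wordP.
have dR x : R x -> almost C (fun i => (d %| gaps l m i x)%Z).
  by move=> [f _ <-]; apply: almost_imp (gaps_eval w lm f) => // i ->.
have [j [j' [lt_j Rx]]] := rational_pump ratR (@word_values_conj w _) Rg hP.
have bad := almost_and (almost_and (dR _ Rg) (dR _ Rx))
  (almost_and (gapsM lm g (h j' * (h j)^-1)) (gapsM lm (h j') (h j)^-1)).
have [||i i_in [[dg dx] [ex eh]]] := almost_ex (s := iota (j' * N)%N N) bad.
- exact: iota_uniq.
- by rewrite size_iota.
have i_notin : i \notin iota (j * N)%N N.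
  move: i_in; rewrite !mem_iota.
  have : (j.+1 * N <= j' * N)%N by rewrite leq_mul2r lt_j orbT.
  rewrite mulSn; lia.
have h1 : gaps l m i (h j') = 1%R.
  by rewrite gaps_train // count_uniq_mem ?iota_uniq // i_in.
have h0 : gaps l m i (h j) = 0%R.
  by rewrite gaps_train // count_uniq_mem ?iota_uniq // (negbTE i_notin).
move: dx; rewrite ex eh gaps_inv h1 h0 rpredDl // oppr0 addr0.
by rewrite dvdz1 absz_nat => /eqP dd; rewrite dd in d1.
Qed.

Theorem theorem5p6 (F : groupType) (F_free : free_group F)
  (F_nonabelian : ~ commutative (@mul F)) (w : word) (w_proper : proper_word w) :
  ~ rational (word_values w F).
Proof.
have [phi [phiM phi_onto]] := free_group_onto_rank2 F_free F_nonabelian.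
case: w_proper => [[G wG] [H /exponent_value_neq1/exponent_value_dvd[d d1 wd]]].
move=> /(rational_image phiM); rewrite word_values_image //.
apply: word_values_rank2_not_rational d1 wd => w1; apply: wG.
apply/seteqP; split=> y /=; rewrite w1.
  by move=> [g _ <-]; rewrite /freeGroup_eval big_nil.
by move=> ->; exists (fun=> 1) => //; rewrite /freeGroup_eval big_nil.
Qed.
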